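(* Suppose that $(Y,T,\kappa)$ is an extension of a topologically transitive Markov map $(X,\theta,\mu,\alpha)$ by a graph $\mathcal{G}=(\mathbf{V},\mathbf{E})$. Then $\mathcal{G}$ is $\mu$-amenable if and only if there exists a $\kappa$-Følner sequence.
   Context: Markov map. $(X,\theta,\mu,\alpha)$ consists of a standard probability space $(X,\mathcal{B},\mu)$, an at most countable partition $\alpha$ of $X$ into measurable sets of positive measure, and $\theta:X\to X$ such that for all $a,b\in\alpha$: $\theta|_a:a\to\theta(a)$ is invertible, bimeasurable and non-singular; and either $\mu(a\cap\theta(b))=0$ or $\mu(a\cap\theta(b)^c)=0$; moreover the sets $[w_1\ldots w_n]=\bigcap_{k=1}^n\theta^{-k+1}(w_k)$, $w_i\in\alpha$, $n\ge1$, generate $\mathcal{B}$ mod $\mu$. It is topologically transitive if for all $a,b\in\alpha$ there is $n\in\mathbb{N}$ with $\mu(\theta^n(a)\cap b)>0$. $\mathcal{W}^1=\alpha$; $\mathcal{W}^n$ is the set of admissible words $w=(w_1\ldots w_n)$, $w_i\in\alpha$, i.e. $\theta(w_i)\supset w_{i+1}$ (mod $\mu$); $\mathcal{W}^\infty=\bigcup_{n\ge1}\mathcal{W}^n$. Graph extension. A graph is directed, $\mathbf{V}$ at most countable, $\mathbf{E}\subset\mathbf{V}\times\mathbf{V}$, $s(e),t(e)$ denote source and target of $e$. $\kappa:X\times\mathbf{V}\to\mathbf{V}$, $(x,g)\mapsto\kappa_x(g)$, is a nearest neighbour cocycle: each $\kappa_x$ is a bijection of $\mathbf{V}$, $(g,\kappa_x(g))\in\mathbf{E}$,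 and $\kappa_x=\kappa_y$ whenever $x,y$ lie in the same element of $\alpha$. $Y=X\times\mathbf{V}$ and $T(x,g)=(\theta(x),\kappa_x(g))$. For $v\in\mathcal{W}^n$ and $x\in[v]$, $\kappa_v=\kappa_{\theta^{n-1}(x)}\circ\cdots\circ\kappa_{\theta(x)}\circ\kappa_x$. $\mu$-amenability: with $p(e)=\mu(\{x\in X:\kappa_x(s(e))=t(e)\})$ and $\partial^\epsilon K=\{v\in K:\exists e\in\mathbf{E}, s(e)=v, t(e)\notin K, p(e)>\epsilon\}$, $\mathcal{G}$ is $\mu$-amenable if $\lim_{\epsilon\to0}\inf\{|\partial^\epsilon K|/|K|:K\subset\mathbf{V},0<|K|<\infty\}=0$. A $\kappa$-Følner sequence is a sequence $(K_n)$ of finite nonempty subsets of $\mathbf{V}$ such that, for all $v\in\mathcal{W}^\infty$, $\lim_{n\to\infty}|\kappa_v(K_n)\setminus K_n|/|K_n|=0$. *)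

(* Defs.v *)
From HB Require Import structures.
From mathcomp Require Import all_boot all_order all_algebra finmap.
From mathcomp Require Import all_classical all_reals all_analysis.

Set Implicit Arguments.
Unset Strict Implicit.
Unset Printing Implicit Defensive.

Import Order.TTheory GRing.Theory Num.Theory.
Import numFieldNormedType.Exports.

Local Open Scope classical_set_scope.
Local Open Scope ring_scope.

Section MarkovMap.
Context {R : realType} {d : measure_display} {X : measurableType d}.
Variables (mu : probability X R) (theta : X -> X) (alpha : set (set X)).

(* Up to a null set, X is in bijection with a Polish space M (a separable
   complete metric space) in such a way that the sigma-algebra of X lies between
   the Borel sigma-algebra of M and its completion.  Hence both standard Borel
   probability spaces and their completions (Lebesgue-Rokhlin spaces) qualify. *)
Definition standard_probability : Prop :=
  exists (M : completePseudoMetricType R) (X0 : set X) (f : X -> M),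
    [/\ hausdorff_space M /\ (exists2 D : set M, countable D & dense D),
        measurable X0 /\ mu X0 = 1%E,
        set_bij X0 [set: M] f,
        (forall B, <<s @open M >> B -> measurable (X0 `&` f @^-1` B)) &
        (forall A, measurable A -> A `<=` X0 ->
           exists B1 B2 : set M, [/\ <<s @open M >> B1, <<s @open M >> B2,
             X0 `&` f @^-1` B1 `<=` A, A `<=` f @^-1` B2 &
             mu (X0 `&` f @^-1` (B2 `\` B1)) = 0%E])].

(* [w_1 ... w_n]; words are sequences of sets and are indexed from 0. *)
Definition cylinder (w : seq (set X)) : set X :=
  [set x | forall k, (k < size w)%N -> nth set0 w k (iter k theta x)].

Record markov_map : Prop := {
  markov_standard : standard_probability;
  markov_countable : countable alpha;
  markov_partition : partition alpha id [set: X];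
  markov_measurable : forall a, alpha a -> measurable a;
  markov_positive : forall a, alpha a -> (0 < mu a)%E;
  markov_invertible : forall a, alpha a -> set_bij a (theta @` a) theta;
  markov_measurable_fun : forall a, alpha a -> measurable_fun a theta;
  markov_measurable_image : forall a, alpha a ->
    forall A, measurable A -> A `<=` a -> measurable (theta @` A);
  markov_nonsingular : forall a, alpha a ->
    forall A, measurable A -> A `<=` a ->
      (mu A = 0%E <-> mu (theta @` A) = 0%E);
  markov_property : forall a b, alpha a -> alpha b ->
    mu (a `&` theta @` b) = 0%E \/ mu (a `&` ~` (theta @` b)) = 0%E;
  markov_generating : forall A, measurable A ->
    exists2 B, <<s [set cylinder w | w in
                      [set w | (0 < size w)%N /\
                         forall k, (k < size w)%N -> alpha (nth set0 w k)]] >> B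
             & mu (A `+` B) = 0%E }.

Definition topologically_transitive : Prop :=
  forall a b, alpha a -> alpha b ->
    exists n : nat, (0 < mu ((iter n theta @` a) `&` b))%E.

Definition admissible_words_of_length (n : nat) : set (seq (set X)) :=
  [set w | [/\ size w = n,
     forall k, (k < n)%N -> alpha (nth set0 w k) &
     forall k, (k.+1 < n)%N ->
       mu (nth set0 w k.+1 `\` theta @` nth set0 w k) = 0%E]].

Definition admissible_words : set (seq (set X)) :=
  \bigcup_(n in [set n | (0 < n)%N]) admissible_words_of_length n.

End MarkovMap.

Section GraphExtension.
Context {R : realType} {d : measure_display} {X : measurableType d}.
Variables (mu : probability X R) (theta : X -> X) (alpha : set (set X)).
Context {V : countType}.
Variables (E : set (V * V)) (kappa : X -> V -> V).

Record nearest_neighbour_cocycle : Prop := {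
  cocycle_bijective : forall x, bijective (kappa x);
  cocycle_edge : forall x g, E (g, kappa x g);
  cocycle_constant : forall a, alpha a -> forall x y, a x -> a y ->
    kappa x = kappa y }.

Record graph_extension (T : X * V -> X * V) : Prop := {
  extension_cocycle : nearest_neighbour_cocycle;
  extension_map : forall x g, T (x, g) = (theta x, kappa x g) }.

Fixpoint iter_cocycle (n : nat) (x : X) : V -> V :=
  if n is m.+1 then kappa (iter m theta x) \o iter_cocycle m x else id.

(* kappa_w is the common value of iter_cocycle (size w) x for x in [w], see
   word_cocycleE; it is the identity if [w] is empty, which does not happen for
   an admissible word, whose cylinder has positive measure. *)
Definition word_cocycle (w : seq (set X)) : V -> V :=
  if pselect (cylinder theta w !=set0) is left w0
  then iter_cocycle (size w) (projT1 (cid w0)) else id.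

Lemma word_cocycleE (w : seq (set X)) (x : X) :
  nearest_neighbour_cocycle ->
  (forall k, (k < size w)%N -> alpha (nth set0 w k)) ->
  cylinder theta w x -> word_cocycle w = iter_cocycle (size w) x.
Proof.
move=> [_ _ kc] aw wx; rewrite /word_cocycle;
  case: pselect => [w0|[]]; last by exists x.
case: cid => y wy /=; move: (leqnn (size w)).
elim: {-2}(size w) => //= n IHn nw; rewrite IHn ?(ltnW nw)//.
by rewrite (kc _ (aw _ nw) _ _ (wy _ nw) (wx _ nw)).
Qed.

Definition edge_probability (e : V * V) : \bar R :=
  mu [set x | kappa x e.1 = e.2].

Definition eps_boundary (eps : R) (K : {fset V}) : {fset V} :=
  [fset v in K | `[< exists e, [/\ E e, e.1 = v, e.2 \notin K &
                                (eps%:E < edge_probability e)%E] >]]%fset.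

Definition mu_amenable : Prop :=
  ereal_inf [set (#|` eps_boundary eps K|%:R / #|` K|%:R)%:E
            | K in [set K : {fset V} | (0 < #|` K|)%N]]
    @[eps --> (0 : R)^'+] --> (0 : \bar R)%E.

Definition kappa_folner (K : nat -> {fset V}) : Prop :=
  (forall n, K n != fset0) /\
  forall w, admissible_words mu theta alpha w ->
    (#|` [fset word_cocycle w g | g in K n] `\` K n|%fset%:R / #|` K n|%:R : R)
      @[n --> \oo] --> (0 : R).

End GraphExtension.

(* Main.v *)
Require Import Defs.
From HB Require Import structures.
From mathcomp Require Import all_boot all_order all_algebra finmap.
From mathcomp Require Import all_classical all_reals all_analysis.

(* The infimum defining mu-amenability increases as eps decreases to 0, so
   amenability says that for each eps > 0 there are finite sets K with
   |eps-boundary of K| / |K| arbitrarily small.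

   A letter a of alpha acts by edges of probability at least mu a > 0; hence for
   eps < mu a the points of K that kappa_a moves out of K lie in the eps-boundary.
   So sets K_n with (1/n)-boundary of relative size less than 1/n satisfy the
   Folner condition for letters, and then for words by subadditivity of
   f |-> |f K \ K| under composition.  Conversely, finitely many letters cover X up
   to measure less than eps, and each edge of probability greater than eps is
   realised by one of them, so |eps-boundary of K| is at most the sum of
   |kappa_a K \ K| over these letters. *)

Set Implicit Arguments.
Unset Strict Implicit.
Unset Printing Implicit Defensive.

Import Order.TTheory GRing.Theory Num.Theory.
Import numFieldNormedType.Exports.

Local Open Scope classical_set_scope.
Local Open Scope ring_scope.

(** * Points moved out of a finite set *)

Section Displacement.
Context {V : choiceType}.
Implicit Types (f h : V -> V) (K : {fset V}).

(** [f] maps the points of [K] that leave [K] bijectively onto the new points. Counting the former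
    keeps everything inside [K], where the boundary lives. *)
Lemma card_displacement f K : injective f ->
  #|` [fset f g | g in K] `\` K|%fset = #|` [fset g in K | f g \notin K]|%fset.
Proof.
move=> finj; transitivity #|` [fset f g | g in [fset g in K | f g \notin K]]|%fset;
  last exact: card_imfset.
congr (#|` _|); apply/fsetP => v; rewrite in_fsetD.
apply/andP/imfsetP => /= [[vK /imfsetP[g /= gK vE]]|[g]].
  by exists g => //; rewrite !inE gK -vE.
by rewrite !inE => /andP[gK fgK] ->; split => //; apply/imfsetP; exists g.
Qed.

(** For a new point [h (f g)], either [f g] is still in [K] and [h] moves it out, or [f g] is
    already new for [f]; [h] does not increase the number of the latter. *)
Lemma displacement_comp f h K :
  (#|` [fset (h \o f) g | g in K] `\` K|%fset <=
   #|` [fset f g | g in K] `\` K|%fset + #|` [fset h g | g in K] `\` K|%fset)%N.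
Proof.
set A := (_ `\` _)%fset; set B := (_ `\` _)%fset; set C := (_ `\` _)%fset.
have /fsubset_leq_card/leq_trans : (A `<=` [fset h g | g in B] `|` C)%fset.
  apply/fsubsetP => v; rewrite in_fsetD => /andP[vK /imfsetP[g /= gK vE]].
  rewrite in_fsetU; have [fgK|fgK] := boolP (f g \in K).
    by apply/orP; right; rewrite in_fsetD vK; apply/imfsetP; exists (f g).
  apply/orP; left; apply/imfsetP; exists (f g) => //=.
  by rewrite in_fsetD fgK; apply/imfsetP; exists g.
apply; rewrite (leq_trans (leq_card_fsetU _ _))// leq_add2r.
exact: leq_imfset_card.
Qed.

Lemma leq_card_sum_cover (A : {fset V}) (B : nat -> {fset V}) n :
  (forall v, v \in A -> exists2 k, (k < n)%N & v \in B k) ->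
  (#|` A| <= \sum_(k < n) #|` B k|)%N.
Proof.
elim: n A => [|n IHn] A AB.
  by rewrite big_ord0 leqn0 cardfs_eq0 -fsubset0; apply/fsubsetP => v /AB[].
rewrite big_ord_recr -(cardfsID (B n)) addnC leq_add//.
  apply: IHn => v; rewrite in_fsetD => /andP[vB /AB[k]].
  rewrite ltnS leq_eqVlt => /orP[/eqP ->|kn vk]; first by rewrite (negbTE vB).
  by exists k.
by rewrite fsubset_leq_card// fsubsetIr.
Qed.

End Displacement.

(** * Exhausting the space by finitely many letters *)

Section Exhaustion.
Context {R : realType} {d : measure_display} {X : measurableType d}.
Variables (mu : probability X R) (alpha : set (set X)).

(** There is at least one letter because the whole space has measure 1. The enumeration may repeat
    letters, so finite partitions are covered too. *)
Lemma countable_partition_enum : countable alpha -> partition alpha id setT ->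
  exists2 a : nat -> set X, forall k, alpha (a k) & \bigcup_k a k = setT.
Proof.
move=> /pfcard_geP[alpha0|[a]] [alphaT _ _].
  have := probability_setT mu; rewrite -alphaT alpha0 /cover bigcup_set0 measure0.
  by move=> /esym/eqP; rewrite onee_eq0.
exists a => [k|]; first exact: funS.
apply/seteqP; split=> // x; rewrite -alphaT => -[A /(@surj _ _ _ _ a)[k _ <-] ax].
by exists k.
Qed.

(** The complements decrease to the empty set, so continuity from above applies. *)
Lemma exhaustion_probability (a : nat -> set X) (eps : R) :
  (forall k, measurable (a k)) -> \bigcup_k a k = setT -> 0 < eps ->
  exists n, (mu (~` \bigcup_(k < n) a k) < eps%:E)%E.
Proof.
move=> ma aT eps0.
have mA n : measurable (\bigcup_(k < n) a k) by exact: bigcup_measurable.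
have : (mu \o (fun n => ~` \bigcup_(k < n) a k)) n @[n --> \oo] --> (0 : \bar R)%E.
  have -> : 0%E = mu (\bigcap_n ~` \bigcup_(k < n) a k).
    rewrite -setC_bigcup -(measure0 mu); congr (mu _).
    rewrite -[LHS]setCT -aT; congr (~` _); apply/seteqP.
    split=> [x [k _ ax]|x [n _ [k _ ax]]].
      by exists k.+1 => //; exists k => /=.
    by exists k.
  apply: nonincreasing_cvg_mu => //.
  - by rewrite (le_lt_trans (probability_le1 _ _)) ?ltry//; exact: measurableC.
  - by move=> n; exact: measurableC.
  - by apply: bigcap_measurable => // n _; exact: measurableC.
  move=> m n mn; apply/subsetPset; apply: subsetC; apply: bigcup_sub => k /= km x ax.
  by exists k => //=; exact: leq_trans km mn.
move=> /fine_cvgP[finA /cvgr_lt/(_ _ eps0) ltA].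
have [n _ /(_ n (leqnn n))[fn ltn]] := filterI finA ltA.
by exists n; rewrite -[ltLHS](fineK fn) lte_fin.
Qed.

End Exhaustion.

(** * Amenability and Folner sequences of a graph extension *)

Section GraphExtension.
Context {R : realType} {d : measure_display} {X : measurableType d}.
Variables (mu : probability X R) (theta : X -> X) (alpha : set (set X)).
Context {V : countType}.
Variables (E : set (V * V)) (kappa : X -> V -> V).
Context (kappa_nnc : nearest_neighbour_cocycle alpha E kappa).
Context (hmarkov : markov_map mu theta alpha).

Lemma eps_boundary_anti (e1 e2 : R) (K : {fset V}) : e1 <= e2 ->
  (eps_boundary mu E kappa e2 K `<=` eps_boundary mu E kappa e1 K)%fset.
Proof.
move=> e12; apply/fsubsetP => v; rewrite !inE => /andP[-> /asboolP[e [Ee ev eK pe]]].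
by apply/asboolP; exists e; split => //; apply: le_lt_trans pe; rewrite lee_fin.
Qed.

Lemma mu_amenableP : mu_amenable mu E kappa <->
  forall eps delta : R, 0 < eps -> 0 < delta -> exists2 K : {fset V},
    K != fset0 & #|` eps_boundary mu E kappa eps K|%:R / #|` K|%:R < delta.
Proof.
rewrite /mu_amenable; split=> [cvg0 eps delta eps0 delta0|small].
  have /fine_cvgP[fin0 /cvgr_lt/(_ _ delta0) lt0] := cvg0.
  (* A set [K] that is good for some [e < eps] is good for [eps], whose boundary is smaller. *)
  near (0 : R)^'+ => e.
  have ee : e < eps by near: e; exact: nbhs_right_lt.
  have : (ereal_inf [set (#|` eps_boundary mu E kappa e K|%:R / #|` K|%:R)%:E
            | K in [set K : {fset V} | (0 < #|` K|)%N]] < delta%:E)%E.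
    by rewrite -[ltLHS]fineK ?lte_fin; near: e.
  move=> /ereal_inf_lt[_ [K /= K0 <-]]; rewrite lte_fin => Kd.
  exists K; first by rewrite -cardfs_gt0.
  apply: le_lt_trans Kd; rewrite ler_wpM2r ?invr_ge0// ler_nat.
  by apply: fsubset_leq_card; apply: eps_boundary_anti; exact: ltW.
(* The infimum is exactly 0 for every positive [eps]. *)
apply: cvg_near_cst; near=> eps; apply/eqP; rewrite eq_le; apply/andP; split.
  apply/lee_addgt0Pr => delta delta0; rewrite add0e.
  have eps0 : 0 < eps by near: eps; exact: nbhs_right_gt.
  have [K K0 /ltW Kd] := small eps delta eps0 delta0.
  apply: (@le_trans _ _ (#|` eps_boundary mu E kappa eps K|%:R / #|` K|%:R)%:E).
    by apply: ereal_inf_lbound; exists K => //=; rewrite cardfs_gt0.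
  by rewrite lee_fin.
by apply: le_ereal_inf_tmp => _ [K _ <-]; rewrite lee_fin divr_ge0.
Unshelve. all: by end_near. Qed.

(** As [kappa] is constant on letters, this set is a countable union of letters. *)
Lemma measurable_edge (e : V * V) : measurable [set x | kappa x e.1 = e.2].
Proof.
have [a aa aT] := countable_partition_enum mu (markov_countable hmarkov)
  (markov_partition hmarkov).
rewrite -[X in measurable X]setTI -aT setI_bigcupl; apply: bigcup_measurable => k _.
have [[x [ax xe]]|noe] := pselect (a k `&` [set x | kappa x e.1 = e.2] !=set0).
  rewrite setIidl; first exact: (markov_measurable hmarkov).
  by move=> y ay /=; rewrite (cocycle_constant kappa_nnc (aa k) ay ax).
by move/nonemptyPn: noe => ->.
Qed.

Lemma card_displacement_eps_boundary (eps : R) a x (K : {fset V}) :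
  alpha a -> a x -> (eps%:E < mu a)%E ->
  (#|` [fset kappa x g | g in K] `\` K|%fset <=
   #|` eps_boundary mu E kappa eps K|)%N.
Proof.
move=> aa ax epsa; have [kbij kedge kconst] := kappa_nnc.
rewrite card_displacement; last exact: bij_inj.
apply: fsubset_leq_card; apply/fsubsetP => g; rewrite !inE => /andP[-> gK].
(* All points of [a] act on [g] as [x] does, so this edge has probability at least [mu a]. *)
apply/asboolP; exists (g, kappa x g); split => //.
apply: (lt_le_trans epsa); apply: le_measure; rewrite ?inE.
- exact: (markov_measurable hmarkov).
- exact: measurable_edge.
by move=> y ay /=; rewrite (kconst a aa y x).
Qed.

Lemma letter_kappa_folner (K : nat -> {fset V}) :
  (forall n, K n != fset0) ->
  (forall a x, alpha a -> a x ->
    (#|` [fset kappa x g | g in K n] `\` K n|%fset%:R / #|` K n|%:R : R)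
      @[n --> \oo] --> (0 : R)) ->
  kappa_folner mu theta alpha kappa K.
Proof.
move=> K0 Kfol; split=> // w [n /= n0 [wn aw _]].
have cvg0id : (#|` [fset id g | g in K m] `\` K m|%fset%:R / #|` K m|%:R : R)
    @[m --> \oo] --> (0 : R).
  by apply: cvg_near_cst; near=> m; rewrite imfset_id fsetDv cardfs0 mul0r.
have [[x wx]|w0] := pselect (cylinder theta w !=set0); last first.
  (* On an empty cylinder the default value is the identity, which displaces nothing. *)
  have -> : word_cocycle theta kappa w = id by rewrite /word_cocycle; case: pselect.
  exact: cvg0id.
rewrite -wn in aw; rewrite (word_cocycleE kappa_nnc aw wx).
have: (size w <= size w)%N by [].
(* Induction on the length of a prefix of [w], with [x] fixed: the next factor is the cocycle at the
   [k]-th iterate of [x], which lies in the [k]-th letter. *)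
elim: {1 3}(size w) => [_|k IHk kw] /=.
  exact: cvg0id.
have := cvgD (IHk (ltnW kw)) (Kfol _ _ (aw _ kw) (wx _ kw)); rewrite addr0.
move=> sum0; apply: (squeeze_cvgr _ (cvg_cst 0) (sum0 _)); near=> m.
rewrite divr_ge0//= addrfctE -mulrDl ler_wpM2r ?invr_ge0// -natrD ler_nat.
exact: displacement_comp.
Unshelve. all: by end_near. Qed.

Lemma mu_amenable_kappa_folner : mu_amenable mu E kappa ->
  exists K : nat -> {fset V}, kappa_folner mu theta alpha kappa K.
Proof.
move=> /mu_amenableP small.
(* One sequence serves all letters: the boundary threshold 1/(n+1) eventually drops below each
   [mu a], and the same number bounds the ratio. *)
have /choice[K KP] : forall n, exists K : {fset V}, K != fset0 /\
    #|` eps_boundary mu E kappa n.+1%:R^-1 K|%:R / #|` K|%:R < n.+1%:R^-1 :> R.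
  move=> n; have n0 : 0 < n.+1%:R^-1 :> R by rewrite invr_gt0.
  by have [K ? ?] := small _ _ n0 n0; exists K.
exists K; apply: letter_kappa_folner => [n|a x aa ax]; first exact: (KP n).1.
have fa : mu a \is a fin_num.
  by rewrite fin_num_measure//; exact: (markov_measurable hmarkov).
have a0 : 0 < fine (mu a).
  by rewrite -lte_fin fineK//; exact: (markov_positive hmarkov).
apply: (squeeze_cvgr _ (cvg_cst 0) cvg_harmonic); near=> n.
rewrite divr_ge0//=; apply: le_trans (ltW (KP n).2).
rewrite ler_wpM2r ?invr_ge0// ler_nat.
apply: (card_displacement_eps_boundary _ aa ax).
rewrite -(fineK fa) lte_fin; near: n.
exact: cvgr_lt cvg_harmonic _ a0.
Unshelve. all: by end_near. Qed.

(** The points realising [e] have measure greater than [eps], so they cannot all lie outside the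
    first [n] letters. *)
Lemma edge_letter (a : nat -> set X) n (eps : R) (e : V * V) :
  (forall k, measurable (a k)) ->
  (mu (~` \bigcup_(k < n) a k) < eps%:E)%E ->
  (eps%:E < edge_probability mu kappa e)%E ->
  exists k x, [/\ (k < n)%N, a k x & kappa x e.1 = e.2].
Proof.
move=> ma alt elt; apply: contrapT => noe.
have := lt_trans alt elt; rewrite ltNge => /negP; apply.
apply: le_measure; rewrite ?inE; first exact: measurable_edge.
  by apply: measurableC; exact: bigcup_measurable.
by move=> x xe [k kn ax]; apply: noe; exists k, x.
Qed.

Lemma kappa_folner_letter (K : nat -> {fset V}) a x :
  kappa_folner mu theta alpha kappa K -> alpha a -> a x ->
  (#|` [fset kappa x g | g in K n] `\` K n|%fset%:R / #|` K n|%:R : R)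
    @[n --> \oo] --> (0 : R).
Proof.
move=> [_ Kfol] aa ax.
have := Kfol [:: a]; rewrite (word_cocycleE (w := [:: a]) (x := x) kappa_nnc).
- by apply; exists 1%N => //; split=> // -[].
- by case.
- by case.
Qed.

Lemma kappa_folner_mu_amenable (K : nat -> {fset V}) :
  kappa_folner mu theta alpha kappa K -> mu_amenable mu E kappa.
Proof.
move=> Kfol; apply/mu_amenableP => eps delta eps0 delta0.
have [a aa aT] := countable_partition_enum mu (markov_countable hmarkov)
  (markov_partition hmarkov).
have ma k : measurable (a k) by exact: (markov_measurable hmarkov).
have [n an] := exhaustion_probability mu ma aT eps0.
(* The point [x k] represents the action of the letter [a k]. *)
have /choice[x ax] : forall k, exists x, a k x.
  by move=> k; case: (markov_partition hmarkov) => _ _; apply.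
pose D k m := ([fset kappa (x k) g | g in K m] `\` K m)%fset.
have bnd m : (#|` eps_boundary mu E kappa eps (K m)| <= \sum_(k < n) #|` D k m|)%N.
  have kinj y : injective (kappa y) by exact/bij_inj/(cocycle_bijective kappa_nnc).
  under eq_bigr do rewrite card_displacement//.
  apply: (leq_card_sum_cover
    (B := fun k => [fset g in K m | kappa (x k) g \notin K m]%fset)).
  move=> v; rewrite !inE => /andP[vK /asboolP[e [_ ev eK pe]]].
  have [k [y [kn ay ye]]] := edge_letter ma an pe.
  exists k => //; rewrite !inE vK /=.
  by rewrite -ev (cocycle_constant kappa_nnc (aa k) (ax k) ay) ye.
(* Since [n] was chosen from [eps] alone, independently of [m], this is a fixed finite sum of null
   sequences. *)
have D0 : (\sum_(k < n) (#|` D k m|%:R / #|` K m|%:R : R)) @[m --> \oo] --> (0 : R).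
  elim: n {an bnd} => [|n IHn].
    by under eq_fun do rewrite big_ord0; exact: cvg_cst.
  under eq_fun do rewrite big_ord_recr.
  have := cvgD IHn (kappa_folner_letter Kfol (aa n) (ax n)).
  by rewrite addr0; apply.
have [m /= Dm] := filter_ex (cvgr_lt _ D0 _ delta0).
exists (K m); first exact: Kfol.1.
apply: le_lt_trans Dm; rewrite -mulr_suml ler_wpM2r ?invr_ge0// -natr_sum ler_nat.
exact: bnd.
Qed.

End GraphExtension.

Theorem proposition2p8 (R : realType) (d : measure_display)
    (X : measurableType d) (mu : probability X R) (theta : X -> X)
    (alpha : set (set X)) (V : countType) (E : set (V * V))
    (kappa : X -> V -> V) (T : X * V -> X * V)
    (hmarkov : markov_map mu theta alpha)
    (htrans : topologically_transitive mu theta alpha)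
    (hext : graph_extension theta alpha E kappa T) :
  mu_amenable mu E kappa <->
  exists K : nat -> {fset V}, kappa_folner mu theta alpha kappa K.
Proof.
have [kappa_nnc _] := hext; split; first exact: mu_amenable_kappa_folner.
by case=> K; exact: kappa_folner_mu_amenable.
Qed.
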